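(* Let $N\ge2$ be even, $M_2=N/2$, and let $a$ be odd. The linear code over $\mathbb{Z}_N$ generated by the rows of $$g=\begin{pmatrix} M_2 & M_2 & 0 & 0 & 0 \\ {} M_2 & 0 & M_2 & 1 & -1 \\ 0 & 0 & 0 & a & -a \end{pmatrix}$$ is isomorphic to the code generated by the rows of $$g_0=\begin{pmatrix} M_2 & M_2 & 0 & 0 & 0 \\ {} M_2 & 0 & M_2 & 0 & 0 \\ 0 & 0 & 0 & 1 & -1 \end{pmatrix}.$$ This is a direct sum; in particular, the corresponding simplex is a free join of $2\Delta_2$ and a $1$-dimensional interval of length $N$.
   Context: $\mathbb{Z}_N=\mathbb{Z}/N\mathbb{Z}$. A linear code of length $n$ over $\mathbb{Z}_N$ is a submodule of $\mathbb{Z}_N^n$. Two codes over the same $\mathbb{Z}_N$ and of the same length are isomorphic if they coincide after a permutation of coordinates. Direct sum: for codes $C_1$ over $\mathbb{Z}_{N_1}$ and $C_2$ over $\mathbb{Z}_{N_2}$, with $L=\operatorname{lcm}(N_1,N_2)$, $C_1\oplus C_2$ is the code over $\mathbb{Z}_L$ consisting of all concatenations $\frac{L}{N_1}c_1\,|\,\frac{L}{N_2}c_2$, $c_i\in C_i$. Simplex of a code: for a code $C\subseteq\mathbb{Z}_N^{d+1}$ all of whose words have coordinate sum $0\bmod N$, let $M=\pi^{-1}(C)\subseteq\mathbb{Z}^{d+1}$ with $\pi:\mathbb{Z}^{d+1}\to\mathbb{Z}_N^{d+1}$ the reduction map; the corresponding simplex is $\operatorname{conv}(Ne_0,\dots,Ne_d)$,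 viewed as a lattice simplex with respect to the affine lattice $\operatorname{aff}(Ne_0,\dots,Ne_d)\cap M$. Lattice simplices are considered up to affine unimodular isomorphism. $2\Delta_2=\operatorname{conv}\{(0,0),(2,0),(0,2)\}\subset\mathbb{R}^2$. The free join of lattice polytopes $\Delta_1,\Delta_2$ of dimensions $d_1,d_2$ is $\operatorname{conv}(\Delta_1\times\{0^{d_2}\}\times\{0\},\ \{0^{d_1}\}\times\Delta_2\times\{1\})\subset\mathbb{R}^{d_1+d_2+1}$. *)

(* Defs.v *)
From HB Require Import structures.
From mathcomp Require Import all_boot all_order all_fingroup all_algebra.
From mathcomp Require Import boolp classical_sets reals.

Set Implicit Arguments.
Unset Strict Implicit.
Unset Printing Implicit Defensive.

Import Order.TTheory GRing.Theory Num.Theory.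

Local Open Scope ring_scope.

Definition mx_of_rows (T : pzRingType) (m n : nat) (rows : seq (seq T)) :
    'M[T]_(m, n) :=
  \matrix_(i < m, j < n) (nth [::] rows i)`_j.

(* 'Z_N is Z/NZ only for N > 1; all definitions on codes presuppose this. *)
Record linear_code (N n : nat) := LinearCode {
  words :> {set 'rV['Z_N]_n};
  words_submod : submod_closed words }.

Lemma row_span_submod (N m n : nat) (g : 'M['Z_N]_(m, n)) :
  submod_closed [set u *m g | u : 'rV['Z_N]_m].
Proof.
split=> [|k _ _ /imsetP[u _ ->] /imsetP[v _ ->]]; apply/imsetP.
  by exists 0; rewrite ?mul0mx.
by exists (k *: u + v); rewrite // mulmxDl scalemxAl.
Qed.

Definition row_code (N m n : nat) (g : 'M['Z_N]_(m, n)) : linear_code N n :=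
  LinearCode (row_span_submod g).

Definition code_isomorphic (N n : nat) (C D : linear_code N n) : Prop :=
  exists s : 'S_n, words D = [set col_perm s w | w in words C].

(* c |-> (L / N) c, from (Z/NZ)^n to (Z/LZ)^n, for N dividing L *)
Definition scale_word (L N n : nat) (c : 'rV['Z_N]_n) : 'rV['Z_L]_n :=
  \row_j ((L %/ N) * c ord0 j)%:R.

(* A relation rather than an operation, so that the modulus of C need only be
   provably, not definitionally, equal to lcm(N1, N2). *)
Definition is_direct_sum (N1 n1 N2 n2 L : nat) (C1 : linear_code N1 n1)
    (C2 : linear_code N2 n2) (C : linear_code L (n1 + n2)) : Prop :=
  L = lcmn N1 N2 /\
  words C = [set row_mx (scale_word L c1) (scale_word L c2)
              | c1 in words C1, c2 in words C2].

Definition zero_sum (N n : nat) (C : linear_code N n) : Prop :=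
  forall w, w \in words C -> \sum_j w ord0 j = 0.

Definition gen_g (N : nat) (a : int) : 'M['Z_N]_(3, 5) :=
  let M2 : 'Z_N := (N %/ 2)%:R in
  mx_of_rows 3 5 [:: [:: M2; M2; 0; 0; 0];
                     [:: M2; 0; M2; 1; -1];
                     [:: 0; 0; 0; a%:~R; - a%:~R]].

Definition gen_g0 (N : nat) : 'M['Z_N]_(3, 5) :=
  let M2 : 'Z_N := (N %/ 2)%:R in
  mx_of_rows 3 5 [:: [:: M2; M2; 0; 0; 0];
                     [:: M2; 0; M2; 0; 0];
                     [:: 0; 0; 0; 1; -1]].

(* The upper left block of gen_g0 is x (1 1 0; 1 0 1) with x = N/2. *)
Definition gen_left (N : nat) (x : 'Z_N) : 'M['Z_N]_(2, 3) :=
  mx_of_rows 2 3 [:: [:: x; x; 0]; [:: x; 0; x]].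

Definition gen_right (N : nat) : 'M['Z_N]_(1, 2) :=
  mx_of_rows 1 2 [:: [:: 1; -1]].

Section LatticePolytopes.
Context {R : realType}.
Local Open Scope classical_set_scope.

Definition aff_hull (n : nat) (S : set 'rV[R]_n) : set 'rV[R]_n :=
  [set x | exists (k : nat) (l : 'I_k -> R) (p : 'I_k -> 'rV[R]_n),
     [/\ \sum_i l i = 1, forall i, S (p i) & x = \sum_i l i *: p i]].

Definition conv_hull (n : nat) (S : set 'rV[R]_n) : set 'rV[R]_n :=
  [set x | exists (k : nat) (l : 'I_k -> R) (p : 'I_k -> 'rV[R]_n),
     [/\ forall i, 0 <= l i, \sum_i l i = 1, forall i, S (p i)
       & x = \sum_i l i *: p i]].

(* A subset of R^n together with the affine lattice it is considered in *)
Record latticed_set (n : nat) := LatticedSet {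
  body : set 'rV[R]_n;
  lattice : set 'rV[R]_n }.

Definition Zn (n : nat) : set 'rV[R]_n :=
  [set map_mx intr z | z in [set: 'rV[int]_n]].

Definition standard (n : nat) (P : set 'rV[R]_n) : latticed_set n :=
  LatticedSet P (@Zn n).

(* An affine map between the affine spans of the two lattices extends to an
   affine map x |-> x A + b of the ambient spaces; it is only required to be
   injective on the affine span of the source lattice, and it is then onto the
   affine span of the target lattice since it maps lattice onto lattice. *)
Definition unimodular_iso (m n : nat) (P : latticed_set m)
    (Q : latticed_set n) : Prop :=
  exists (A : 'M[R]_(m, n)) (b : 'rV[R]_n),
    let f := fun x : 'rV[R]_m => x *m A + b in
    [/\ {in aff_hull (lattice P) &, injective f},
        f @` lattice P = lattice Q
      & f @` body P = body Q].

Definition code_preimage (N n : nat) (C : linear_code N n) : set 'rV[int]_n :=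
  [set z | map_mx (fun k : int => k%:~R : 'Z_N) z \in words C].

Definition dilated_basis (N n : nat) : set 'rV[R]_n :=
  [set N%:R *: delta_mx ord0 i | i in [set: 'I_n]].

Definition code_simplex (N n : nat) (C : linear_code N n) : latticed_set n :=
  LatticedSet (conv_hull (dilated_basis (n := n) N))
    (aff_hull (dilated_basis (n := n) N) `&` map_mx intr @` code_preimage C).

Definition free_join (d1 d2 : nat) (P : set 'rV[R]_d1) (Q : set 'rV[R]_d2) :
    set 'rV[R]_(d1 + d2 + 1) :=
  conv_hull
    ([set row_mx (row_mx x (0 : 'rV_d2)) (0 : 'rV_1) | x in P] `|`
     [set row_mx (row_mx (0 : 'rV_d1) y) (const_mx 1 : 'rV_1) | y in Q]).

Definition two_Delta2 : set 'rV[R]_2 :=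
  conv_hull [set mx_of_rows 1 2 [:: [:: 0; 0]];
                 mx_of_rows 1 2 [:: [:: 2; 0]];
                 mx_of_rows 1 2 [:: [:: 0; 2]]].

Definition interval_of_length (N : nat) : set 'rV[R]_1 :=
  [set x | 0 <= x ord0 ord0 <= N%:R].

End LatticePolytopes.

Arguments gen_left N x : clear implicits.
Arguments two_Delta2 R : clear implicits.
Arguments interval_of_length R N : clear implicits.
Arguments code_simplex R {N n} C.

(* Main.v *)
(* Writing a = 2b + 1 and using 2 (N/2) = 0 in Z/NZ, the two codes are equal, not
   merely isomorphic.  A word of the common code is
   (N/2 (u + v), N/2 u, N/2 v, t, -t), so the lattice points of its simplex are the
   integer points with coordinate sum N, x_1 and x_2 divisible by N/2 and x_3 + x_4
   divisible by N, whence x |-> (2 x_1 / N, 2 x_2 / N, x_4, (x_3 + x_4) / N) is the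
   isomorphism onto the free join. *)
Require Import Defs.
From HB Require Import structures.
From mathcomp Require Import all_boot all_order all_fingroup all_algebra.
From mathcomp Require Import boolp classical_sets reals.
From mathcomp Require Import ring lra zify.
Import Order.TTheory GRing.Theory Num.Theory.
Local Open Scope ring_scope.

(** * Row vectors written out as explicit lists *)

Local Notation rowv n s := (mx_of_rows 1 n [:: s]).

(** Destructing the list [s] names all coordinates of a vector at once, so matrix products become
    explicit formulas. *)
Lemma rowvP (T : pzRingType) (n : nat) (v : 'rV[T]_n) :
  exists2 s : seq T, size s = n & v = rowv n s.
Proof.
exists [seq v 0 j | j <- enum 'I_n]; first by rewrite size_map size_enum_ord.
apply/rowP=> j; rewrite mxE (nth_map j) ?size_enum_ord //=.
by rewrite nth_ord_enum.
Qed.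

Lemma row_mx_rowv (T : pzRingType) (m n : nat) (s t : seq T) :
  size s = m -> row_mx (rowv m s) (rowv n t) = rowv (m + n) (s ++ t).
Proof.
move=> sz_s; apply/rowP=> j; rewrite !mxE /= nth_cat sz_s.
by case: splitP => k e; rewrite mxE /= e ?addKn.
Qed.

Lemma map_rowv (T U : pzRingType) (f : T -> U) (n : nat) (s : seq T) :
  f 0 = 0 -> map_mx f (rowv n s) = rowv n (map f s).
Proof.
move=> f0; apply/rowP=> j; rewrite !mxE /=.
have [lt_j|le_j] := ltnP j (size s); first by rewrite (nth_map 0).
by rewrite !nth_default ?size_map.
Qed.

Lemma scale_row_mx_of_rows (T : pzRingType) (m n : nat) (rows : seq (seq T))
    (c : T) (i : 'I_m) :
  c *: row i (mx_of_rows m n rows) = rowv n [seq c * x | x <- nth [::] rows i].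
Proof. by rewrite -map_rowv ?mulr0 //; apply/rowP=> j; rewrite !mxE. Qed.

Lemma Zp_intr_eq0 (N : nat) (z : int) :
  (1 < N)%N -> ((z%:~R : 'Z_N) == 0) = (N %| z)%Z.
Proof.
move=> N_gt1; suff nat_eq0 n : ((n%:R : 'Z_N) == 0) = (N %| n)%N.
  by case: z => n; rewrite ?NegzE ?mulrNz ?oppr_eq0 ?dvdzN -?pmulrn nat_eq0.
by rewrite Zp_nat -val_eqE /= Zp_cast.
Qed.

(** * The words of the two codes *)

Section Codes.
Variables (N : nat) (a : int).
Hypotheses (N_ge2 : (2 <= N)%N) (N_even : (2 %| N)%N).

Let M2 : 'Z_N := (N %/ 2)%:R.

Lemma half_double : M2 + M2 = 0.
Proof.
by rewrite -natrD addnn -muln2 divnK // pchar_Zp.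
Qed.

(** The parameters [u], [v], [t] are the coefficients on the three rows of [gen_g0]. *)
Definition word_g0 (u v t : 'Z_N) : 'rV['Z_N]_5 :=
  rowv 5 [:: M2 * (u + v); M2 * u; M2 * v; t; - t].

Lemma mem_gen_g0 (w : 'rV['Z_N]_5) :
  (w \in words (row_code (gen_g0 N))) <-> exists u v t, w = word_g0 u v t.
Proof.
split=> [/imsetP[x _ ->]|[u [v [t ->]]]].
  have [[|u [|v [|t []]]] // _ ->] := rowvP _ _ x.
  exists u, v, t; apply/rowP=> -[[|[|[|[|[|j]]]]] lt_j] //;
    rewrite !mxE !big_ord_recl big_ord0 !mxE /= -/M2; ring.
apply/imsetP; exists (rowv 3 [:: u; v; t]) => //.
apply/rowP=> -[[|[|[|[|[|j]]]]] lt_j] //;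
    rewrite !mxE !big_ord_recl big_ord0 !mxE /= -/M2; ring.
Qed.

(** In the last two columns every row of [gen_g] is a multiple of (1, -1), so its words already have
    the shape [word_g0], with a third parameter tied to [v]. *)
Lemma mem_gen_g (w : 'rV['Z_N]_5) :
  (w \in words (row_code (gen_g N a))) <->
  exists u v t, w = word_g0 u v (v + t * a%:~R).
Proof.
split=> [/imsetP[x _ ->]|[u [v [t ->]]]].
  have [[|u [|v [|t []]]] // _ ->] := rowvP _ _ x.
  exists u, v, t; apply/rowP=> -[[|[|[|[|[|j]]]]] lt_j] //;
    rewrite !mxE !big_ord_recl big_ord0 !mxE /= -/M2; ring.
apply/imsetP; exists (rowv 3 [:: u; v; t]) => //.
apply/rowP=> -[[|[|[|[|[|j]]]]] lt_j] //;
    rewrite !mxE !big_ord_recl big_ord0 !mxE /= -/M2; ring.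
Qed.

(* With a = 2b + 1, the word (u, v, t) of g0 has coefficients u,
   v - 2b(t - v), t - v on the rows of g. *)
Lemma words_gen_g (a_odd : ~~ (2 %| a)%Z) :
  words (row_code (gen_g N a)) = words (row_code (gen_g0 N)).
Proof.
have M2D := half_double.
have [b aE] : exists b : int, a = 2 * b + 1.
  by exists (a %/ 2)%Z; lia.
apply/setP=> w; apply/idP/idP; last first.
  move=> /mem_gen_g0[u [v [t ->]]]; apply/mem_gen_g.
  exists u, (v - b%:~R * (t - v) - b%:~R * (t - v)), (t - v).
  (* An even shift vanishes under [M2]; this is applied both to [v] and to [u + v]. *)
  have M2b x : M2 * (x - b%:~R * (t - v) - b%:~R * (t - v)) = M2 * x.
    transitivity (M2 * x - (M2 + M2) * b%:~R * (t - v)); first by ring.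
    by rewrite M2D !mul0r subr0.
  rewrite /word_g0 M2b !addrA M2b.
  (* The fourth coordinate is v - 2b(t - v) + (2b + 1)(t - v) = t. *)
  by congr (rowv 5 [:: _; _; _; _; - _]); rewrite aE rmorphD rmorphM /=; ring.
by move=> /mem_gen_g[u [v [t ->]]]; apply/mem_gen_g0; do 3!eexists.
Qed.

Lemma zero_sum_g0 : zero_sum (row_code (gen_g0 N)).
Proof.
move=> w /mem_gen_g0[u [v [t ->]]].
rewrite !big_ord_recl big_ord0 !mxE /=.
transitivity ((M2 + M2) * (u + v)); first by ring.
by rewrite half_double mul0r.
Qed.

(** * Direct sum decompositions of the code of [gen_g0] *)

(** The modulus is arbitrary because the left summand is taken over ['Z_N] with x = N/2 and over
    ['Z_2] with x = 1. *)
Lemma mem_gen_left K (x : 'Z_K) (w : 'rV['Z_K]_3) :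
  (w \in words (row_code (gen_left K x))) <->
  exists u v, w = rowv 3 [:: x * (u + v); x * u; x * v].
Proof.
split=> [/imsetP[y _ ->]|[u [v ->]]].
  have [[|u [|v []]] // _ ->] := rowvP _ _ y.
  exists u, v; apply/rowP=> -[[|[|[|j]]] lt_j] //;
    rewrite !mxE !big_ord_recl big_ord0 !mxE /=; ring.
apply/imsetP; exists (rowv 2 [:: u; v]) => //.
apply/rowP=> -[[|[|[|j]]] lt_j] //;
  rewrite !mxE !big_ord_recl big_ord0 !mxE /=; ring.
Qed.

Lemma mem_gen_right K (w : 'rV['Z_K]_2) :
  (w \in words (row_code (gen_right K))) <-> exists t, w = rowv 2 [:: t; - t].
Proof.
split=> [/imsetP[y _ ->]|[t ->]].
  have [[|t []] // _ ->] := rowvP _ _ y.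
  exists t; apply/rowP=> -[[|[|j]] lt_j] //;
    rewrite !mxE !big_ord_recl big_ord0 !mxE /=; ring.
apply/imsetP; exists (rowv 1 [:: t]) => //.
apply/rowP=> -[[|[|j]] lt_j] //;
  rewrite !mxE !big_ord_recl big_ord0 !mxE /=; ring.
Qed.

Lemma scale_word_id n (c : 'rV['Z_N]_n) : scale_word N c = c.
Proof.
by apply/rowP=> j; rewrite mxE divnn ltnW // mul1n natr_Zp.
Qed.

(** Since 2 [M2] = 0, multiplication by [M2] factors through reduction mod 2. *)
Lemma half_odd n : M2 * n%:R = M2 * (odd n)%:R.
Proof.
rewrite -[in LHS](odd_double_half n) natrD mulrDr -addnn natrD mulrDr.
by rewrite -mulrDl half_double mul0r addr0.
Qed.

(** The scaling factor from modulus 2 to modulus N is N/2. Reducing an entry mod 2 keeps its parity,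
    which is all that [M2] sees. *)
Lemma scale_word_half (c0 c1 c2 : nat) :
  scale_word N (rowv 3 [:: c0%:R; c1%:R; c2%:R] : 'rV['Z_2]_3) =
  rowv 3 [:: M2 * c0%:R; M2 * c1%:R; M2 * c2%:R].
Proof.
have val2 (c : nat) : ((c%:R : 'Z_2) : nat) = odd c by rewrite Zp_nat -modn2.
by apply/rowP=> -[[|[|[|j]]] lt_j] //;
  rewrite !mxE /= natrM -/M2 [RHS]half_odd val2.
Qed.

Lemma direct_sum_gen_g0 :
  is_direct_sum (row_code (gen_left N M2)) (row_code (gen_right N))
    (row_code (gen_g0 N)).
Proof.
split; first by apply/esym/lcmn_idPl.
apply/setP=> w; apply/idP/imset2P=> [/mem_gen_g0[u [v [t ->]]]|[c1 c2]].
  exists (rowv 3 [:: M2 * (u + v); M2 * u; M2 * v]) (rowv 2 [:: t; - t]).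
  - by apply/mem_gen_left; do 2!eexists.
  - by apply/mem_gen_right; eexists.
  by rewrite !scale_word_id row_mx_rowv.
move=> /mem_gen_left[u [v ->]] /mem_gen_right[t ->] ->.
rewrite !scale_word_id row_mx_rowv //.
by apply/mem_gen_g0; exists u, v, t.
Qed.

(** Here the left summand is the binary even-weight code of length 3; the factor N/2 comes from the
    scaling in the direct sum. *)
Lemma direct_sum_gen_g0_half :
  is_direct_sum (row_code (gen_left 2 1)) (row_code (gen_right N))
    (row_code (gen_g0 N)).
Proof.
split; first by apply/esym/lcmn_idPr.
have scale_half (u v : nat) :
    scale_word N (rowv 3 [:: 1 * (u%:R + v%:R); 1 * u%:R; 1 * v%:R] : 'rV['Z_2]_3)
    = rowv 3 [:: M2 * (u%:R + v%:R); M2 * u%:R; M2 * v%:R].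
  by rewrite !mul1r -!natrD scale_word_half.
apply/setP=> w; apply/idP/imset2P=> [/mem_gen_g0[u [v [t ->]]]|[c1 c2]].
  exists (rowv 3 [:: 1 * ((u : nat)%:R + (v : nat)%:R); 1 * (u : nat)%:R;
                     1 * (v : nat)%:R]) (rowv 2 [:: t; - t]).
  - by apply/mem_gen_left; do 2!eexists.
  - by apply/mem_gen_right; eexists.
  by rewrite scale_word_id scale_half row_mx_rowv // !natr_Zp.
move=> /mem_gen_left[u [v ->]] /mem_gen_right[t ->] ->.
rewrite -[u]natr_Zp -[v]natr_Zp scale_word_id scale_half row_mx_rowv //.
by apply/mem_gen_g0; do 3!eexists.
Qed.

Lemma half_multiple (z : int) (u : 'Z_N) :
  z%:~R = M2 * u -> exists y : int, z = (N %/ 2)%:Z * y.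
Proof.
move=> zE; have : ((z - (N %/ 2)%:Z * (u : nat)%:Z)%:~R : 'Z_N) == 0.
  by rewrite rmorphB rmorphM /= -!pmulrn natr_Zp zE subrr.
rewrite Zp_intr_eq0 // => /dvdzP[q zq].
(* From z - (N/2) u = q N and N = 2 (N/2). *)
exists (q * 2 + (u : nat)%:Z).
have NE : N%:Z = (N %/ 2)%:Z * 2 by rewrite -PoszM divnK.
move: zq; rewrite NE => zq; rewrite mulrDr mulrA; lia.
Qed.

End Codes.

(** * Convex and affine hulls *)

Section Hulls.
Context {R : realType}.

(** Column j of [B] and entry j of [c] describe one half-space. The affine map commutes with convex
    combinations, so it suffices to test the points of [S]. *)
Lemma conv_hull_halfspaces (n m : nat) (S : set 'rV[R]_n) (B : 'M[R]_(n, m))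
    (c : 'rV[R]_m) :
  (forall p, S p -> forall j, 0 <= (p *m B + c) 0 j) ->
  forall x, conv_hull S x -> forall j, 0 <= (x *m B + c) 0 j.
Proof.
move=> S_ge0 _ [k [l [p [l_ge0 l1 Sp ->]]]] j.
have -> : (\sum_i l i *: p i) *m B + c = \sum_i l i *: (p i *m B + c).
  under [RHS]eq_bigr do rewrite scalerDr scalemxAl.
  by rewrite big_split /= -scaler_suml l1 scale1r mulmx_suml.
rewrite summxE sumr_ge0 // => i _.
by rewrite mxE mulr_ge0 // S_ge0.
Qed.

Lemma mem_conv_hull (n : nat) (S : set 'rV[R]_n) (x : 'rV[R]_n) :
  S x -> conv_hull S x.
Proof.
move=> Sx; exists 1%N, (fun=> 1), (fun=> x).
by split=> //; rewrite big_ord1 ?scale1r.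
Qed.

Lemma aff_hull_sum (n : nat) (S : set 'rV[R]_n) (c : R) :
  (forall p, S p -> \sum_j p 0 j = c) ->
  forall x, aff_hull S x -> \sum_j x 0 j = c.
Proof.
move=> Sc _ [k [l [p [l1 Sp ->]]]].
under eq_bigr do rewrite summxE.
rewrite exchange_big /= -[c]mul1r -l1 mulr_suml; apply: eq_bigr => i _.
by rewrite -(Sc _ (Sp i)) mulr_sumr; apply: eq_bigr => j _; rewrite mxE.
Qed.

Lemma sum_dilated_basis (N n : nat) (p : 'rV[R]_n) :
  dilated_basis N p -> \sum_j p 0 j = N%:R.
Proof.
case=> i _ <-; rewrite (bigD1 i) //= big1 => [|j ne_ji].
  by rewrite !mxE !eqxx mulr1 addr0.
by rewrite !mxE (negPf ne_ji) andbF mulr0.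
Qed.

Section DilatedBasis.
Variables (N n : nat) (x : 'rV[R]_n).
Hypotheses (N_gt0 : (0 < N)%N) (sum_x : \sum_j x 0 j = N%:R).

(** The quotients x_i / N are the barycentric coordinates of x with respect to the vertices N
    e_i. *)
Lemma sum_coord_div : \sum_j x 0 j / N%:R = 1.
Proof. by rewrite -mulr_suml sum_x divff // pnatr_eq0 -lt0n. Qed.

Lemma dilated_basis_expand :
  x = \sum_i (x 0 i / N%:R) *: (N%:R *: delta_mx 0 i).
Proof.
rewrite [LHS]row_sum_delta; apply: eq_bigr => i _.
by rewrite scalerA divfK // pnatr_eq0 -lt0n.
Qed.

Lemma aff_hull_dilated_basis : aff_hull (dilated_basis (n := n) N) x.
Proof.
exists n, (fun i => x 0 i / N%:R), (fun i => N%:R *: delta_mx 0 i).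
by split=> [|i|]; [exact: sum_coord_div | exists i | exact: dilated_basis_expand].
Qed.

Lemma conv_hull_dilated_basis :
  (forall j, 0 <= x 0 j) -> conv_hull (dilated_basis (n := n) N) x.
Proof.
move=> x_ge0; exists n, (fun i => x 0 i / N%:R), (fun i => N%:R *: delta_mx 0 i).
split=> [i||i|]; first by rewrite divr_ge0.
- exact: sum_coord_div.
- by exists i.
exact: dilated_basis_expand.
Qed.

End DilatedBasis.

Lemma two_Delta2_ineqs (p : 'rV[R]_2) : two_Delta2 R p ->
  [/\ 0 <= p 0 0, 0 <= p 0 1 & p 0 0 + p 0 1 <= 2].
Proof.
(* The columns, with the shift (0, 0, 2), are the facets x >= 0, y >= 0 and 2 - x - y >= 0. *)
pose B : 'M[R]_(2, 3) := mx_of_rows 2 3 [:: [:: 1; 0; -1]; [:: 0; 1; -1]].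
have BE (x y : R) :
    rowv 2 [:: x; y] *m B + rowv 3 [:: 0; 0; 2] = rowv 3 [:: x; y; 2 - x - y].
  apply/rowP=> -[[|[|[|j]]] lt_j] //; rewrite !mxE !big_ord_recl big_ord0 !mxE /=; ring.
move=> /(conv_hull_halfspaces _ _ _ B (rowv 3 [:: 0; 0; 2])).
have [[|x [|y []]] // _ ->] := rowvP _ _ p => ineqs.
have {}ineqs j : 0 <= (rowv 3 [:: x; y; 2 - x - y] : 'rV[R]_3) 0 j.
  rewrite -BE; apply: ineqs => {j} q + j.
  by move=> [[->|->]|->]; rewrite BE; case: j => -[|[|[|j]]] lt_j //; rewrite mxE /=; lra.
have := ineqs 0; have := ineqs 1; have := ineqs 2%:R.
by rewrite !mxE /= => h2 h1 h0; split=> //; lra.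
Qed.

End Hulls.

(** * The affine map onto the free join: injectivity, lattice and body *)

Section FreeJoin.
Context {R : realType}.
Variable N : nat.
Hypotheses (N_ge2 : (2 <= N)%N) (N_even : (2 %| N)%N).

Let N_neq0 : N%:R != 0 :> R.
Proof. by rewrite pnatr_eq0 -lt0n ltnW. Qed.

Let halfE : (N %/ 2)%:R = N%:R / 2 :> R.
Proof. by rewrite -[in RHS](divnK N_even) natrM mulfK ?pnatr_eq0. Qed.

(* N e_0, ..., N e_4 are sent to the vertices (0,0;0;0), (2,0;0;0), (0,2;0;0),
   (0,0;0;1), (0,0;N;1) of the free join. *)
Definition join_mx : 'M[R]_(5, 2 + 1 + 1) :=
  mx_of_rows 5 (2 + 1 + 1)
    [:: [:: 0; 0; 0; 0]; [:: 2 / N%:R; 0; 0; 0]; [:: 0; 2 / N%:R; 0; 0];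
        [:: 0; 0; 0; N%:R^-1]; [:: 0; 0; 1; N%:R^-1]].

(** With [join_inv_shift], this is the affine inverse of [join_mx] on the hyperplane of coordinate
    sum N. The origin goes to N e_0, and each row is the image of a unit vector minus N e_0. *)
Definition join_inv_mx : 'M[R]_(2 + 1 + 1, 5) :=
  mx_of_rows (2 + 1 + 1) 5
    [:: [:: - (N%:R / 2); N%:R / 2; 0; 0; 0];
        [:: - (N%:R / 2); 0; N%:R / 2; 0; 0];
        [:: 0; 0; 0; -1; 1]; [:: - N%:R; 0; 0; N%:R; 0]].

Definition join_inv_shift : 'rV[R]_5 := rowv 5 [:: N%:R; 0; 0; 0; 0].

Lemma mul_join_mx (x0 x1 x2 x3 x4 : R) :
  rowv 5 [:: x0; x1; x2; x3; x4] *m join_mx =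
  rowv (2 + 1 + 1)
    [:: 2 / N%:R * x1; 2 / N%:R * x2; x4; N%:R^-1 * (x3 + x4)].
Proof.
by apply/rowP=> -[[|[|[|[|j]]]] lt_j] //;
  rewrite !mxE !big_ord_recl big_ord0 !mxE /=; ring.
Qed.

Lemma mul_join_inv_mx (y1 y2 t h : R) :
  rowv (2 + 1 + 1) [:: y1; y2; t; h] *m join_inv_mx + join_inv_shift =
  rowv 5 [:: N%:R * (1 - h - y1 / 2 - y2 / 2); N%:R * (y1 / 2);
             N%:R * (y2 / 2); N%:R * h - t; t].
Proof.
by apply/rowP=> -[[|[|[|[|[|j]]]]] lt_j] //;
  rewrite !mxE !big_ord_recl big_ord0 !mxE /=; ring.
Qed.

Lemma sum_rowv5 (T : pzRingType) (x0 x1 x2 x3 x4 : T) :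
  \sum_j (rowv 5 [:: x0; x1; x2; x3; x4] : 'rV[T]_5) 0 j =
  x0 + x1 + x2 + x3 + x4.
Proof. by rewrite !big_ord_recl big_ord0 !mxE /= addr0 !addrA. Qed.

(** The image determines x_1, x_2, x_4 and x_3 + x_4; the coordinate sum then recovers x_0. *)
Lemma join_mx_inj (x y : 'rV[R]_5) :
  \sum_j x 0 j = N%:R -> \sum_j y 0 j = N%:R ->
  x *m join_mx = y *m join_mx -> x = y.
Proof.
have [[|x0 [|x1 [|x2 [|x3 [|x4 []]]]]] // _ ->] := rowvP _ _ x.
have [[|y0 [|y1 [|y2 [|y3 [|y4 []]]]]] // _ ->] := rowvP _ _ y.
rewrite !sum_rowv5 !mul_join_mx => sum_x sum_y /rowP eq_xy.
have two_div : 2 / N%:R != 0 :> R by rewrite mulf_neq0 ?invr_eq0 // pnatr_eq0.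
have := eq_xy 0; have := eq_xy 1; have := eq_xy 2%:R; have := eq_xy 3%:R.
rewrite !mxE /= => /(mulfI (invr_neq0 N_neq0)) e3 e4.
move=> /(mulfI two_div) e2 /(mulfI two_div) e1.
by congr (rowv 5 [:: _; _; _; _; _]); lra.
Qed.

Lemma join_mx_lattice :
  (mulmxr join_mx @` lattice (code_simplex R (row_code (gen_g0 N))) = @Zn R _)%classic.
Proof.
apply/seteqP; split=> [_ [x [sum_x [z Cz <-]] <-]|_ [z _ <-]] /=.
  have [[|z0 [|z1 [|z2 [|z3 [|z4 []]]]]] // _ zE] := rowvP _ _ z.
  move: Cz; rewrite /code_preimage /= zE map_rowv // => /mem_gen_g0.
  move=> [u [v [t /rowP e]]].
  have := e 1; have := e 2%:R; have := e 3%:R; have := e 4%:R.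
  rewrite !mxE /= => e4 e3 /half_multiple-/(_ N_ge2 N_even)[y2 ->].
  move=> /half_multiple-/(_ N_ge2 N_even)[y1 ->].
  (* The entries t and -t of a codeword cancel, which makes the height coordinate an integer. *)
  have /dvdzP[k kE] : (N %| z3 + z4)%Z.
    by rewrite -Zp_intr_eq0 // rmorphD /= e3 e4 subrr.
  exists (rowv (2 + 1 + 1) [:: y1; y2; z4; k]) => //.
  rewrite !map_rowv // mul_join_mx -rmorphD /= kE !rmorphM /= -!pmulrn halfE.
  by congr (rowv _ [:: _; _; _; _]); field.
have [[|y1 [|y2 [|t [|k []]]]] // _ ->] := rowvP _ _ z.
pose M2 : int := (N %/ 2)%:Z.
(* The inverse affine map evaluated at [z], over the integers. *)
pose z' : 'rV[int]_5 := rowv 5 [:: N%:Z - M2 * y1 - M2 * y2 - N%:Z * k;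
  M2 * y1; M2 * y2; N%:Z * k - t; t].
exists (map_mx intr z').
  split; last first.
    exists z' => //; rewrite /code_preimage /= map_rowv //; apply/mem_gen_g0.
    exists y1%:~R, y2%:~R, (- t%:~R); rewrite /word_g0 /=.
    rewrite !rmorphB !rmorphM /= -!pmulrn pchar_Zp // mul0r !sub0r subr0 opprK.
    congr (rowv 5 [:: _; _; _; _; _]).
    (* Modulo N the first coordinate is -[M2] (y1 + y2), which equals [M2] (y1 + y2) because 2 [M2]
       = 0. *)
    apply/eqP; rewrite -subr_eq0 -opprD -opprD oppr_eq0 -mulrDr -mulrDl.
    by rewrite half_double // mul0r.
  apply: aff_hull_dilated_basis; first exact: ltnW.
  rewrite map_rowv //= sum_rowv5 !rmorphB !rmorphM /= -!pmulrn; ring.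
rewrite !map_rowv //= mul_join_mx !rmorphB !rmorphM /= -!pmulrn halfE.
by congr (rowv _ [:: _; _; _; _]); field.
Qed.

Lemma join_leftE (p1 p2 : R) :
  row_mx (row_mx (rowv 2 [:: p1; p2]) 0) 0 = rowv (2 + 1 + 1) [:: p1; p2; 0; 0].
Proof.
have -> : 0 = rowv 1 [:: 0] :> 'rV[R]_1.
  by apply/rowP=> j; rewrite ord1 !mxE.
by rewrite !row_mx_rowv.
Qed.

Lemma join_rightE (t : R) :
  row_mx (row_mx 0 (rowv 1 [:: t])) (const_mx 1) =
  rowv (2 + 1 + 1) [:: 0; 0; t; 1].
Proof.
have -> : const_mx 1 = rowv 1 [:: 1] :> 'rV[R]_1.
  by apply/rowP=> j; rewrite ord1 !mxE.
have -> : 0 = rowv 2 [:: 0; 0] :> 'rV[R]_2.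
  by apply/rowP=> -[[|[|j]] lt_j] //; rewrite !mxE.
by rewrite !row_mx_rowv.
Qed.

Lemma join_mx_body :
  (mulmxr join_mx @` conv_hull (@dilated_basis R N 5) =
   free_join (two_Delta2 R) (interval_of_length R N))%classic.
Proof.
apply/seteqP; split=> [_ [_ [k [l [p [l_ge0 l1 Sp ->]]]] <-]|y].
  exists k, l, (fun i => p i *m join_mx); split=> // [i|]; last first.
    by rewrite /= mulmx_suml; apply: eq_bigr => i _; rewrite scalemxAl.
  have [j _ <-] := Sp i; rewrite -scalemxAl -rowE.
  rewrite scale_row_mx_of_rows.
  case: j => -[|[|[|[|[|j]]]]] lt_j //=;
    rewrite ?mulr0 ?mulr1 ?divff // ?(mulrC _ (2 / _)) ?divfK //.
  - left; exists (rowv 2 [:: 0; 0]); last exact: join_leftE.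
    by apply: mem_conv_hull; left; left.
  - left; exists (rowv 2 [:: 2; 0]); last exact: join_leftE.
    by apply: mem_conv_hull; left; right.
  - left; exists (rowv 2 [:: 0; 2]); last exact: join_leftE.
    by apply: mem_conv_hull; right.
  - right; exists (rowv 1 [:: 0]); last exact: join_rightE.
    by rewrite /interval_of_length /= mxE /= lexx ler0n.
  - right; exists (rowv 1 [:: N%:R]); last exact: join_rightE.
    by rewrite /interval_of_length /= mxE /= lexx ler0n.
(* The coordinates of the inverse image are N times the barycentric coordinates. Their nonnegativity
   has to be tested only on the two pieces of the join, at heights 0 and 1. *)
move=> /(conv_hull_halfspaces _ _ _ join_inv_mx join_inv_shift) y_ge0.
have [[|y1 [|y2 [|t [|h []]]]] // _ yE] := rowvP _ _ y.
exists (y *m join_inv_mx + join_inv_shift); last first.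
  rewrite /= yE mul_join_inv_mx mul_join_mx.
  by congr (rowv _ [:: _; _; _; _]); field.
apply: conv_hull_dilated_basis; first exact: ltnW.
  by rewrite yE mul_join_inv_mx sum_rowv5; field.
apply: y_ge0 => {y y1 y2 t h yE} _ [[p /two_Delta2_ineqs + <-]|[p + <-]] j.
  have [[|p1 [|p2 []]] // _ ->] := rowvP _ _ p.
  rewrite join_leftE mul_join_inv_mx !mxE /= => -[p1_ge0 p2_ge0 le2].
  by case: j => -[|[|[|[|[|j]]]]] lt_j //=; rewrite ?subr0 ?mulr0 //;
    rewrite mulr_ge0 ?ler0n //; lra.
have [[|t []] // _ ->] := rowvP _ _ p.
rewrite join_rightE mul_join_inv_mx /interval_of_length /= !mxE /=.
move=> /andP[t_ge0 t_leN].
by case: j => -[|[|[|[|[|j]]]]] lt_j //=; lra.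
Qed.


End FreeJoin.

(** * The unimodular isomorphism and the transfer between the codes *)

Lemma unimodular_iso_gen_g0 (R : realType) (N : nat) :
  (2 <= N)%N -> (2 %| N)%N ->
  unimodular_iso (code_simplex R (row_code (gen_g0 N)))
    (standard (free_join (two_Delta2 R) (interval_of_length R N))).
Proof.
move=> N_ge2 N_even; exists (join_mx N), 0 => f.
have -> : f = mulmxr (join_mx N) by apply: funext => x; rewrite /f addr0.
split; last 2 first.
- exact: join_mx_lattice.
- exact: join_mx_body.
(* The lattice lies in the hyperplane of coordinate sum N, hence so does its affine hull, and there
   [join_mx] is injective. *)
have sum_lattice x : aff_hull (lattice (code_simplex R (row_code (gen_g0 N)))) x ->
    \sum_j x 0 j = N%:R.
  apply: aff_hull_sum => p [+ _].
  by apply: aff_hull_sum => q; apply: sum_dilated_basis.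
move=> x y /set_mem/sum_lattice sum_x /set_mem/sum_lattice sum_y.
exact: join_mx_inj.
Qed.

Theorem lemma3p10 (R : realType) (N : nat) (a : int)
    (N_ge2 : (2 <= N)%N) (N_even : (2 %| N)%N) (a_odd : ~~ (2 %| a)%Z) :
  let C := row_code (gen_g N a) in
  let C0 := row_code (gen_g0 N) in
  let freejoin :=
    standard (free_join (two_Delta2 R) (interval_of_length R N)) in
  [/\ code_isomorphic C C0,
      is_direct_sum (row_code (gen_left N (N %/ 2)%:R)) (row_code (gen_right N)) C0
      /\ is_direct_sum (row_code (gen_left 2 1)) (row_code (gen_right N)) C0,
      zero_sum C /\ unimodular_iso (code_simplex R C) freejoin
    & zero_sum C0 /\ unimodular_iso (code_simplex R C0) freejoin].
Proof.
move=> C C0 freejoin.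
have eq_words : words C = words C0 by apply: words_gen_g.
have iso0 : zero_sum C0 /\ unimodular_iso (code_simplex R C0) freejoin.
  by split; [apply: zero_sum_g0 | apply: unimodular_iso_gen_g0].
split=> //; first 1 last.
- by split; [apply: direct_sum_gen_g0 | apply: direct_sum_gen_g0_half].
(* Both properties depend on the code only through its set of words. *)
- by rewrite /zero_sum /code_simplex /code_preimage eq_words.
(* As the codes are equal, the identity permutation works. *)
exists 1%g; rewrite -eq_words; apply/setP=> w; apply/idP/imsetP=> [Cw|[v Cv ->]].
  by exists w; rewrite ?col_perm1.
by rewrite col_perm1.
Qed.
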